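(* Let $f$ be a vector field on a manifold $M$ and $L:M\to\mathbb R$ a function. Let $(q,p)$ be an integral curve of the augmented adjoint system $i_{X_{H_L}}\Omega=dH_L$ on $T^*M$, with $H_L(q,p)=\langle p,f(q)\rangle+L(q)$, and let $(q,\delta q)$ be an integral curve of the variational equation of $\dot q=f(q)$, covering the same curve $q$. Then $$\frac{d}{dt}\langle p,\delta q\rangle=-\langle dL,\delta q\rangle.$$
   Context: All manifolds and maps are smooth. $\Omega=dq\wedge dp$ is the canonical symplectic form on $T^*M$. In coordinates the augmented adjoint system is $\dot q^A=f^A(q)$, $\dot p_A=-p_B\frac{\partial f^B(q)}{\partial q^A}-\frac{\partial L(q)}{\partial q^A}$. The variational equation is $\frac{d}{dt}(q,\delta q)=\widetilde f(q,\delta q)$ on $TM$, where $\widetilde f(q,\delta q)=\frac{d}{d\epsilon}\big|_{\epsilon=0}T\Phi_\epsilon(q,\delta q)$ is the tangent lift of $f$ and $\Phi_\epsilon$ is the (local) flow of $f$; in coordinates $\dot q^A=f^A(q)$, $\frac{d}{dt}\delta q^A=\frac{\partial f^A(q)}{\partial q^B}\delta q^B$. $\langle\cdot,\cdot\rangle$ is the pairing of $T^*_qM$ with $T_qM$, and $dL$ is evaluated at $q(t)$. *)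

(* Defs.v *)
From HB Require Import structures.
From mathcomp Require Import all_boot all_order all_algebra.
From mathcomp Require Import all_classical all_reals all_analysis.
Set Implicit Arguments.
Unset Strict Implicit.
Unset Printing Implicit Defensive.
Import Order.TTheory GRing.Theory Num.Theory.
Import numFieldNormedType.Exports.
Local Open Scope classical_set_scope.
Local Open Scope ring_scope.

(* C^k and C^oo functions on an open set U of a finite-dimensional space: g is
   C^{k+1} iff it is Frechet differentiable on U and all its directional
   derivatives are C^k on U. *)
Fixpoint Ck_on (R : realType) (V W : normedModType R) (k : nat)
    (U : set V) (g : V -> W) : Prop :=
  match k with
  | 0%N => forall x, U x -> {for x, continuous g}
  | k'.+1 => (forall x, U x -> differentiable g x) /\
             (forall v : V, Ck_on k' U ('D_v g))
  end.

Definition smooth_on (R : realType) (V W : normedModType R)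
    (U : set V) (g : V -> W) : Prop := forall k, Ck_on k U g.

(* The data of an n-dimensional atlas on T: the chart c maps the domain [dom c]
   to R^n by [coord c], with inverse [param c] ([coord c] and [param c] are
   irrelevant outside [dom c] and its image).  [chart_at x] is a chart around x;
   the notions below that use it do not depend on this choice of chart.
   The data is kept apart from the manifold axioms so that the bundle charts of
   TM and T*M are available as definitions. *)
Record atlas (R : realType) (n : nat) (T : Type) := Atlas {
  chart : Type;
  dom : chart -> set T;
  coord : chart -> T -> 'rV[R]_n;
  param : chart -> 'rV[R]_n -> T;
  chart_at : T -> chart
}.

Definition transition (R : realType) (n : nat) (T : Type) (A : atlas R n T)
  (c d : chart A) : 'rV[R]_n -> 'rV[R]_n := coord d \o param c.

Record smooth_manifold (R : realType) (n : nat) (M : topologicalType)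
    (A : atlas R n M) : Prop := SmoothManifold {
  manifold_hausdorff : hausdorff_space M;
  manifold_second_countable : @second_countable M;
  dom_chart_at : forall x, dom (chart_at A x) x;
  open_dom : forall c : chart A, open (dom c);
  open_coord : forall c : chart A, open (coord c @` dom c);
  coordK : forall (c : chart A) x, dom c x -> param c (coord c x) = x;
  coord_continuous : forall (c : chart A) x, dom c x ->
    {for x, continuous (coord c)};
  param_continuous : forall (c : chart A) y, (coord c @` dom c) y ->
    {for y, continuous (param c)};
  transition_smooth : forall c d : chart A,
    smooth_on (coord c @` (dom c `&` dom d)) (transition c d)
}.

Section TangentSpace.
Context (R : realType) (n : nat) (T : Type) (A : atlas R n T) (x : T).

(* A tangent vector at x is a family of components (v c) in the charts c around
   x that transforms by the derivatives of the transition maps.  The components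
   in the charts not containing x are set to 0, so that equality of tangent
   vectors is equality of families. *)
Definition is_tangent (v : chart A -> 'rV[R]_n) : Prop :=
  (forall c, ~ dom c x -> v c = 0) /\
  (forall c d, dom c x -> dom d x ->
     v d = 'd (transition c d) (coord c x) (v c)).

Definition tangent_pred : {pred chart A -> 'rV[R]_n} :=
  fun v => `[< is_tangent v >].

Fact tangent_submod_closed : submod_closed tangent_pred.
Proof.
split=> [|a u v /asboolP[u0 uE] /asboolP[v0 vE]]; apply/asboolP; split=> //.
- by move=> c d _ _; rewrite linear0.
- by move=> c xc; rewrite [LHS](_ : _ = a *: u c + v c)// u0// v0// scaler0 addr0.
- move=> c d xc xd; rewrite [LHS](_ : _ = a *: u d + v d)//.
  by rewrite (uE c d)// (vE c d)// -linearP.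
Qed.

HB.instance Definition _ :=
  GRing.isSubmodClosed.Build R (chart A -> 'rV[R]_n) tangent_pred
    tangent_submod_closed.

Record tangent := Tangent {
  comp :> chart A -> 'rV[R]_n;
  comp_tangent : comp \in tangent_pred
}.

HB.instance Definition _ := [isSub for comp].
HB.instance Definition _ := [Choice of tangent by <:].
HB.instance Definition _ := [SubChoice_isSubLmodule of tangent by <:].

Definition cotangent := {scalar tangent}.

(* The tangent vector at x with components u in the chart c around x; on a
   smooth manifold it exists and is unique, by the chain rule for the transition
   maps (0 is the default value when c is not a chart around x). *)
Definition tvec (c : chart A) (u : 'rV[R]_n) : tangent :=
  xget 0 [set v : tangent | v c = u].

(* the covector with components u in the chart c around x *)
Definition covec_fun (c : chart A) (u : 'rV[R]_n) (v : tangent) : R :=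
  \sum_(i < n) u 0 i * v c 0 i.

Fact covec_is_scalar c u : scalar (covec_fun c u).
Proof.
move=> a v w; rewrite /covec_fun mulr_sumr -big_split/=; apply: eq_bigr => i _.
by rewrite [LHS](_ : _ = u 0 i * (a *: v c + w c) 0 i)// !mxE mulrDr mulrCA.
Qed.

HB.instance Definition _ c u :=
  GRing.isLinear.Build R tangent R *%R (covec_fun c u) (covec_is_scalar c u).

Definition covec (c : chart A) (u : 'rV[R]_n) : cotangent := covec_fun c u.

End TangentSpace.

Section Bundles.
Context (R : realType) (n : nat) (T : Type) (A : atlas R n T).

Definition tangent_bundle : Type := {x : T & tangent A x}.
Definition cotangent_bundle : Type := {x : T & cotangent A x}.

(* natural coordinates (q^i, v^i) on the tangent bundle *)
Definition tangent_atlas : atlas R (n + n) tangent_bundle := {|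
  chart := chart A;
  dom := fun c (w : tangent_bundle) => dom c (projT1 w);
  coord := fun c (w : tangent_bundle) => row_mx (coord c (projT1 w)) (comp (projT2 w) c);
  param := fun c y => existT (tangent A) (param c (lsubmx y))
                        (tvec (param c (lsubmx y)) c (rsubmx y));
  chart_at := fun (w : tangent_bundle) => chart_at A (projT1 w)
|}.

(* the components p_i = <p, d/dq^i> of a covector p at x in the chart c *)
Definition cocomp (x : T) (p : cotangent A x) (c : chart A) : 'rV[R]_n :=
  \row_(i < n) p (tvec x c (delta_mx 0 i)).

(* canonical coordinates (q^i, p_i) on the cotangent bundle *)
Definition cotangent_atlas : atlas R (n + n) cotangent_bundle := {|
  chart := chart A;
  dom := fun c (z : cotangent_bundle) => dom c (projT1 z);
  coord := fun c (z : cotangent_bundle) => row_mx (coord c (projT1 z)) (cocomp (projT2 z) c);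
  param := fun c y => existT (cotangent A) (param c (lsubmx y))
                        (covec (param c (lsubmx y)) c (rsubmx y));
  chart_at := fun (z : cotangent_bundle) => chart_at A (projT1 z)
|}.

Definition vector_field := forall x : T, tangent A x.

Definition smooth_vector_field (f : vector_field) : Prop :=
  forall c : chart A, smooth_on (coord c @` dom c) (fun y => f (param c y) c).

Definition smooth_function (h : T -> R) : Prop :=
  forall c : chart A, smooth_on (coord c @` dom c) (h \o param c).

(* the differential <dh, v> of a function at x *)
Definition dfun (h : T -> R) (x : T) (v : tangent A x) : R :=
  let c := chart_at A x in 'd (h \o param c) (coord c x) (v c).

(* the tangent map T_x g : T_x T -> T_(g x) T of g : T -> T *)
Definition tmap (g : T -> T) (x : T) (v : tangent A x) : tangent A (g x) :=
  let c := chart_at A x in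
  let d := chart_at A (g x) in
  tvec (g x) d ('d (coord d \o g \o param c) (coord c x) (v c)).

(* the curve g passes through x at time t, with velocity v *)
Definition has_velocity (g : R -> T) (t : R) (x : T) (v : tangent A x) : Prop :=
  g t = x /\
  forall c : chart A, dom c x ->
    (\forall s \near t, dom c (g s)) /\ is_derive t 1 (coord c \o g) (v c).

Definition integral_curve (X : vector_field) (I : set R) (g : R -> T) : Prop :=
  forall t, I t -> has_velocity g t (X (g t)).

(* Phi is a local flow of f near x0, defined and smooth on ]-a, a[ x U, with U
   an open neighborhood of x0 inside the domain of a chart c; smoothness of
   (e, x) |-> Phi e x is expressed in the chart c at the source and in any chart
   d at the target. *)
Definition local_flow (f : vector_field) (x0 : T) (Phi : R -> T -> T) : Prop :=
  exists (a : R) (c : chart A) (U : set T),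
  [/\ 0 < a, U x0, U `<=` dom c & open (coord c @` U)] /\
  [/\ forall x, U x -> Phi 0 x = x,
      forall e x, `|e| < a -> U x ->
        has_velocity (Phi^~ x) e (f (Phi e x)) &
      forall e x (d : chart A), `|e| < a -> U x -> dom d (Phi e x) ->
        exists W : set (R * 'rV[R]_n),
        [/\ open W, W (e, coord c x),
            forall y, W y -> dom d (Phi y.1 (param c y.2)) &
            smooth_on W (fun y => coord d (Phi y.1 (param c y.2)))]].

End Bundles.

(* F is the tangent lift of f: F(w) = d/de|_(e = 0) (T Phi_e)(w), with Phi a
   local flow of f around the base point of w; any two such flows have the same
   germ, hence give the same vector. *)
Definition tangent_lift (R : realType) (n : nat) (T : Type) (A : atlas R n T)
    (f : vector_field A) (F : vector_field (tangent_atlas A)) : Prop :=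
  forall w : tangent_bundle A,
  exists Phi : R -> T -> T, local_flow f (projT1 w) Phi /\
    has_velocity
      (fun e => existT (tangent A) (Phi e (projT1 w)) (tmap (Phi e) (projT2 w)))
      0 (F w).

(* the canonical symplectic form dq^i /\ dp_i on T*M *)
Definition symplectic_form (R : realType) (n : nat) (T : Type)
    (A : atlas R n T) (z : cotangent_bundle A)
    (X Y : tangent (cotangent_atlas A) z) : R :=
  let c : chart (cotangent_atlas A) := chart_at (cotangent_atlas A) z in
  let dq (V : tangent (cotangent_atlas A) z) i := lsubmx (V c) 0 i in
  let dp (V : tangent (cotangent_atlas A) z) i := rsubmx (V c) 0 i in
  \sum_(i < n) (dq X i * dp Y i - dp X i * dq Y i).

(* X is the Hamiltonian vector field of H: i_X Omega = dH *)
Definition hamiltonian_field (R : realType) (n : nat) (T : Type)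
    (A : atlas R n T) (H : cotangent_bundle A -> R)
    (X : vector_field (cotangent_atlas A)) : Prop :=
  forall (z : cotangent_bundle A) (Y : tangent (cotangent_atlas A) z),
    symplectic_form (X z) Y = dfun H Y.

(* H_L(q, p) = <p, f(q)> + L(q) *)
Definition adjoint_hamiltonian (R : realType) (n : nat) (T : Type)
    (A : atlas R n T) (f : vector_field A) (L : T -> R)
    (z : cotangent_bundle A) : R :=
  projT2 z (f (projT1 z)) + L (projT1 z).

(* Main.v *)
(* In a chart around q(t), the momentum half of Hamilton's equations reads
   dp_i/dt = - p_j d_i f^j - d_i L and the variational equation reads
   d(dq^j)/dt = d_i f^j dq^i, with dq the variation of q, so the product rule
   leaves - d_i L dq^i.

   Two steps are not immediate from the intrinsic definitions.  Testing
   i_X Omega = dH against the vectors d/dq^i requires that they exist as tangent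
   vectors of T*M, i.e. that the transition maps of T*M are differentiable.  The
   tangent lift is the e-derivative of the y-derivative of the flow Phi_e(y);
   symmetry of second derivatives turns it into the y-derivative of f. *)

Require Import Defs.
From HB Require Import structures.
From mathcomp Require Import all_boot all_order all_algebra.
From mathcomp Require Import all_classical all_reals all_analysis.
Set Implicit Arguments.
Unset Strict Implicit.
Unset Printing Implicit Defensive.
Import Order.TTheory GRing.Theory Num.Theory.
Import numFieldNormedType.Exports Defs.
Local Open Scope classical_set_scope.
Local Open Scope ring_scope.

(** * Calculus: germs, row vectors, linear and affine maps *)

(** The first-order expansion at [x] depends only on the germ of the map, and a continuous linear
    part of such an expansion is unique. Identities between coordinate expressions hold only near a
    point, so differentials are transported along them by this lemma. *)
Lemma near_eq_is_diff {R : numFieldType} {V W : normedModType R}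
    (f g : V -> W) (df : V -> W) (x : V) :
  {near x, f =1 g} -> is_diff x f df -> is_diff x g df.
Proof.
move=> fg [fd <-].
have gE : g \o shift x = cst (g x) + 'd f x +o_ 0 id.
  rewrite -(nbhs_singleton fg); apply/eqaddoP => e e0.
  have /eqaddoP/(_ e e0) := diff_locally fd.
  have : \forall y \near 0, f (y + x) = g (y + x).
    by move: fg; rewrite (near_shift 0 x) /=; apply: filterS => y; rewrite subr0.
  by move=> fgx; apply: filterS2 fgx => y; rewrite /= !fctE /= => ->.
have gd : 'd g x = 'd f x :> (V -> W).
  exact: diff_unique (diff_continuous fd) gE.
have dg : differentiable g x.
  apply/diff_locallyP; rewrite gd; split => //; exact: diff_continuous.
exact: DiffDef dg gd.
Qed.

Lemma near_eq_differentiable {R : numFieldType} {V W : normedModType R}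
    (f g : V -> W) (x : V) :
  {near x, f =1 g} -> differentiable f x -> differentiable g x.
Proof.
by move=> fg /differentiableP df; have /@ex_diff := near_eq_is_diff fg df.
Qed.

Lemma near_eq_diff {R : numFieldType} {V W : normedModType R}
    (f g : V -> W) (x : V) :
  {near x, f =1 g} -> differentiable f x -> 'd g x = 'd f x :> (V -> W).
Proof.
by move=> fg /differentiableP df; have /@diff_val := near_eq_is_diff fg df.
Qed.

Lemma is_diff_comp_at {R : numFieldType} {U V W : normedModType R}
    (f : U -> V) (g : V -> W) (x : U) (y : V) :
  f x = y -> differentiable f x -> differentiable g y ->
  is_diff x (g \o f) ('d g y \o 'd f x).
Proof.
by move=> <- df dg; apply: DiffDef; [exact: differentiable_comp|exact: diff_comp].
Qed.

Lemma differentiable_entry {R : numFieldType} {V : normedModType R} {n : nat}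
    (f : V -> 'rV[R]_n) (x : V) i :
  differentiable f x -> differentiable (fun y => f y 0 i) x.
Proof.
move=> df; have dc := @differentiable_coord R 1 n (f x) 0 i.
exact: differentiable_comp df dc.
Qed.

Lemma differentiable_row {R : numFieldType} {V : normedModType R} {n : nat}
    (f : V -> 'rV[R]_n) (x : V) :
  (forall i, differentiable (fun y => f y 0 i) x) -> differentiable f x.
Proof.
move=> df; have -> : f = \sum_(i < n) (fun y => f y 0 i *: delta_mx 0 i).
  by apply/funext => y; rewrite fct_sumE; exact: row_sum_delta.
by apply: differentiable_sum => i; exact: differentiableZl.
Qed.

Lemma differentiable_row_mx {R : numFieldType} {V : normedModType R} {m n : nat}
    (f : V -> 'rV[R]_m) (g : V -> 'rV[R]_n) (x : V) :
  differentiable f x -> differentiable g x ->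
  differentiable (fun y => row_mx (f y) (g y)) x.
Proof.
move=> df dg; apply: differentiable_row => i.
case: (split_ordP i) => j ->.
- rewrite (_ : (fun _ => _) = (fun y => f y 0 j)).
    exact: differentiable_entry.
  by apply/funext => y; rewrite row_mxEl.
- rewrite (_ : (fun _ => _) = (fun y => g y 0 j)).
    exact: differentiable_entry.
  by apply/funext => y; rewrite row_mxEr.
Qed.

(** A linear map commutes with difference quotients, and continuity lets it pass to their limit. It
    serves to extract the fibre half of a bundle velocity, with [l] being [rsubmx]. *)
Lemma is_derive_linear {R : numFieldType} {V W Z : normedModType R}
    (l : {linear W -> Z}) (f : V -> W) (x v : V) (df : W) :
  continuous l -> is_derive x v f df -> is_derive x v (l \o f) (l df).
Proof.
move=> lc [fxv <-].
have E : (fun h => h^-1 *: ((l \o f \o shift x) (h *: v) - (l \o f) x)) =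
    l \o (fun h => h^-1 *: ((f \o shift x) (h *: v) - f x)).
  by apply/funext => h; rewrite /= linearZZ (linearB l).
have lf : (fun h => h^-1 *: ((l \o f \o shift x) (h *: v) - (l \o f) x)) @ 0^'
    --> l ('D_v f x).
  by rewrite E; apply: continuous_cvg; [exact: lc|exact: fxv].
apply: DeriveDef; first by apply/cvg_ex; eexists; exact: lf.
exact: cvg_lim lf.
Qed.

Lemma is_derive_coord {R : realFieldType} {V : normedModType R} {n : nat}
    (f : V -> 'rV[R]_n) (x v : V) (df : 'rV[R]_n) i :
  is_derive x v f df -> is_derive x v (fun y => f y 0 i) (df 0 i).
Proof.
move=> [fxv <-]; apply: DeriveDef; first exact: (derivable_mxP _ _ _).1 fxv _ _.
by rewrite derive_mx// mxE.
Qed.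

(** Along the line through [x] in direction [u] both sides have the same difference quotients. The
    maps [i] to come are lines in [V] and insertions of one argument of a pair. *)
Lemma is_derive_comp_affine {R : numFieldType} {U V W : normedModType R}
    (i : U -> V) (g : V -> W) (x u : U) (v : V) (dg : W) :
  (forall h : R, i (h *: u + x) = h *: v + i x) ->
  is_derive (i x) v g dg <-> is_derive x u (g \o i) dg.
Proof.
move=> iE.
have E : (fun h : R => h^-1 *: ((g \o shift (i x)) (h *: v) - g (i x))) =
    (fun h : R => h^-1 *: (((g \o i) \o shift x) (h *: u) - (g \o i) x)).
  by apply/funext => h /=; rewrite iE.
by split=> -[gd <-]; apply: DeriveDef; rewrite /derivable /derive ?E// -?E.
Qed.

Lemma derive_comp_affine {R : numFieldType} {U V W : normedModType R}
    (i : U -> V) (g : V -> W) (x u : U) (v : V) :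
  (forall h : R, i (h *: u + x) = h *: v + i x) ->
  'D_v g (i x) = 'D_u (g \o i) x.
Proof.
move=> iE; rewrite /derive (_ : (fun h => _) =
    (fun h : R => h^-1 *: (((g \o i) \o shift x) (h *: u) - (g \o i) x)))//.
by apply/funext => h /=; rewrite iE.
Qed.

(** * Symmetry of second derivatives *)

Section Schwarz.
Context {R : realType} {V : normedModType R}.
Implicit Types (x a b : V) (g : V -> R).

Lemma is_derive_line g x a (s : R) :
  derivable g (s *: a + x) a ->
  is_derive s 1 (fun t => g (t *: a + x)) ('D_a g (s *: a + x)).
Proof.
move=> /derivableP gd.
have iE (h : R) : (h *: 1 + s) *: a + x = h *: a + (s *: a + x).
  by rewrite scalerDl -addrA /GRing.scale /= mulr1.
exact: (@is_derive_comp_affine _ _ _ _ (fun t : R => t *: a + x) g s 1 a _ iE).1 gd.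
Qed.

(* The mean value theorem applied first along a, then along b. *)
Lemma second_difference g (P : set V) x a b z (h : R) : 0 <= h ->
  (forall y, P y -> derivable g y a /\ derivable ('D_a g) y b) ->
  (forall s t : R, 0 <= s <= h -> 0 <= t <= h -> P (s *: a + (t *: b + x))) ->
  z = h *: a + (h *: b + x) ->
  exists2 y, P y &
    g z - g (h *: a + x) - (g (h *: b + x) - g x) = h * h * 'D_b ('D_a g) y.
Proof.
move=> h0 gd hP ->.
have h00 : (0 : R) <= 0 <= h by rewrite lexx.
have hh : 0 <= h <= h by rewrite h0 lexx.
pose phi s := g (s *: a + (h *: b + x)) - g (s *: a + x).
(* The second difference is [phi h - phi 0], and [dphi s] is in turn an increment along [b], to
   which the mean value theorem applies again. *)
pose dphi s := 'D_a g (s *: a + (h *: b + x)) - 'D_a g (s *: a + x).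
have dphiE s : 0 <= s <= h -> is_derive s 1 phi (dphi s).
  move=> sh; apply: is_deriveB; apply: is_derive_line.
    by have [] := gd _ (hP s h sh hh).
  by have [+ _] := gd _ (hP s 0 sh h00); rewrite scale0r add0r.
have [||s sh phiE] := @MVT_segment R phi dphi 0 h h0.
- by move=> s; rewrite in_itv /= => /andP[? ?]; apply: dphiE; rewrite !ltW.
- by apply: derivable_within_continuous => s; rewrite in_itv /= => /dphiE[].
move: sh; rewrite in_itv /= => sh.
pose psi t := 'D_a g (t *: b + (s *: a + x)).
pose dpsi t := 'D_b ('D_a g) (t *: b + (s *: a + x)).
have psiE t : 0 <= t <= h -> is_derive t 1 psi (dpsi t).
  move=> th; apply: is_derive_line; rewrite addrCA.
  by have [] := gd _ (hP s t sh th).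
have [||t th psit] := @MVT_segment R psi dpsi 0 h h0.
- by move=> t; rewrite in_itv /= => /andP[? ?]; apply: psiE; rewrite !ltW.
- by apply: derivable_within_continuous => t; rewrite in_itv /= => /psiE[].
move: th; rewrite in_itv /= => th.
exists (t *: b + (s *: a + x)); first by rewrite addrCA; exact: hP.
move: phiE psit; rewrite /phi /dphi /psi /dpsi subr0 !scale0r !add0r => -> psit.
by rewrite addrCA psit -mulrA mulrC.
Qed.

Let eq_second_difference (u v w z h d1 d2 : R) : h != 0 ->
  u - v - (w - z) = h * h * d1 -> u - w - (v - z) = h * h * d2 -> d1 = d2.
Proof.
move=> h0 E1 E2; apply: (@mulfI _ (h * h)); first exact: mulf_neq0.
rewrite -E1 -E2 !opprB -!addrA; congr (_ + _).
by rewrite addrCA [RHS]addrCA (addrC (- v)).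
Qed.

Let ler_dist_mid (u v w e : R) :
  `|u - w| < e / 2 -> `|v - w| < e / 2 -> `|u - v| <= e.
Proof.
move=> uw vw; rewrite (le_trans (ler_distD w _ _))// [leRHS]splitr ltW// ltrD//.
by rewrite distrC.
Qed.

(** The second difference over a small parallelogram is symmetric in [a] and [b]. Evaluated in both
    orders, it shows that the two mixed derivatives take a common value, at two possibly different
    points near [x]; continuity at [x] concludes. *)
Lemma derive_sym g x a b :
  (\forall y \near x, derivable g y a) -> (\forall y \near x, derivable g y b) ->
  (\forall y \near x, derivable ('D_a g) y b) ->
  (\forall y \near x, derivable ('D_b g) y a) ->
  {for x, continuous ('D_b ('D_a g))} -> {for x, continuous ('D_a ('D_b g))} ->
  'D_b ('D_a g) x = 'D_a ('D_b g) x.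
Proof.
move=> ga gb gab gba cab cba; apply/eqP; rewrite -subr_eq0 -normr_le0.
apply/ler_addgt0Pl => _/posnumP[e]; rewrite addr0.
pose P y := [/\ derivable g y a, derivable g y b, derivable ('D_a g) y b,
  derivable ('D_b g) y a & `|'D_b ('D_a g) x - 'D_b ('D_a g) y| < e%:num / 2 /\
  `|'D_a ('D_b g) x - 'D_a ('D_b g) y| < e%:num / 2].
have nP : \forall y \near x, P y.
  have e2 : 0 < e%:num / 2 by [].
  have {}cab : \forall y \near x, `|'D_b ('D_a g) x - 'D_b ('D_a g) y| < e%:num / 2.
    by move/cvgrPdist_lt : cab => /(_ _ e2).
  have {}cba : \forall y \near x, `|'D_a ('D_b g) x - 'D_a ('D_b g) y| < e%:num / 2.
    by move/cvgrPdist_lt : cba => /(_ _ e2).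
  by apply: filterS (filterI ga (filterI gb (filterI gab (filterI gba
    (filterI cab cba))))) => y [? [? [? [? [? ?]]]]].
have /nbhs_normP[r /= r0 rP] := nP.
have d0 : 0 < `|a| + `|b| + 1 by rewrite ltr_wpDl// addr_ge0.
have [h h0 hP] : exists2 h, 0 < h & forall s t, 0 <= s <= h -> 0 <= t <= h ->
    P (s *: a + (t *: b + x)).
  (* This keeps the whole parallelogram in the ball of radius [r]; the [+ 1] prevents a zero
     denominator when [a] and [b] vanish. *)
  exists (r / (`|a| + `|b| + 1)); first by rewrite divr_gt0.
  set h := r / _ => s t /andP[s0 sh] /andP[t0 th]; apply: rP => /=.
  rewrite addrA opprD addrCA subrr addr0 normrN (le_lt_trans (ler_normD _ _))//.
  rewrite !normrZ !ger0_norm// (@le_lt_trans _ _ (h * (`|a| + `|b|)))//.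
    by rewrite mulrDr lerD// ler_wpM2r.
  by rewrite /h mulrAC ltr_pdivrMr// ltr_pM2l// ltrDl.
have [|//|y Py E1] := @second_difference g P x a b _ h (ltW h0) _ _ erefl.
  by move=> y [].
(* The far corner is kept as the same term as in [E1], so that the two second differences can be
   compared. *)
have [||y' Py' E2] :=
    @second_difference g P x b a _ h (ltW h0) _ _ (addrCA (h *: a) (h *: b) x).
- by move=> y' [].
- by move=> t s th sh; rewrite addrCA; exact: hP.
have E := eq_second_difference (lt0r_neq0 h0) E1 E2.
have [_ _ _ _ [d1 _]] := Py; have [_ _ _ _ [_ d2]] := Py'.
by apply: ler_dist_mid d2; rewrite -E.
Qed.

End Schwarz.

(** Reduces to the scalar case entry by entry. Taking an entry commutes with differentiation only on
    [U], hence the passage through germs for second derivatives. *)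
Lemma Ck2_derive_sym {R : realType} {V : normedModType R} {n : nat}
    (U : set V) (g : V -> 'rV[R]_n) (x a b : V) :
  open U -> U x -> Ck_on 2 U g -> 'D_b ('D_a g) x = 'D_a ('D_b g) x.
Proof.
move=> oU Ux [gd g2].
have nU : \forall y \near x, U y by exact: open_nbhs_nbhs.
have dg u v y : U y -> derivable ('D_u g) y v.
  by move=> Uy; apply: diff_derivable; apply: (g2 u).1.
have dgi i u y : U y -> derivable (fun y => g y 0 i) y u.
  move=> Uy; apply: (derivable_mxP _ _ _).1; apply: diff_derivable; exact: gd.
have dgiE i u y : U y -> 'D_u (fun y => g y 0 i) y = 'D_u g y 0 i.
  by move=> Uy; rewrite derive_mx ?mxE//; exact/diff_derivable/gd.
have dgi2 i u v y : U y -> derivable ('D_u (fun y => g y 0 i)) y v /\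
    'D_v ('D_u (fun y => g y 0 i)) y = 'D_v ('D_u g) y 0 i.
  move=> Uy; have nUy : \forall z \near y, U z by exact: open_nbhs_nbhs.
  have E : \near y, 'D_u g y 0 i = 'D_u (fun y => g y 0 i) y.
    by apply: filterS nUy => z Uz; rewrite dgiE.
  have D : is_derive y v ('D_u g) ('D_v ('D_u g) y).
    exact/derivableP/dg.
  by have [? ?] := near_eq_is_derive E (is_derive_coord i D).
have cont i u v : {for x, continuous ('D_v ('D_u (fun y => g y 0 i)))}.
  have H : (fun y => 'D_v ('D_u g) y 0 i) @ x -->
      'D_v ('D_u (fun y => g y 0 i)) x.
    rewrite (dgi2 i u v x Ux).2.
    have gc := (g2 u).2 v x Ux.
    exact: (cvg_comp _ _ gc (@matrix_normedtype.coord_continuous _ _ _ 0 i _)).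
  apply: cvg_trans H; apply: near_eq_cvg.
  by apply: filterS nU => y Uy; exact/esym/(dgi2 _ _ _ _ Uy).2.
apply/rowP => i.
apply: etrans (dgi2 i b a x Ux).2; apply: etrans (esym (dgi2 i a b x Ux).2) _.
apply: derive_sym.
- by apply: filterS nU => y; exact: dgi.
- by apply: filterS nU => y; exact: dgi.
- by apply: filterS nU => y /(dgi2 i a b)[].
- by apply: filterS nU => y /(dgi2 i b a)[].
- exact: cont.
- exact: cont.
Qed.

(* What the theory of components of tangent vectors at x needs; it holds for M and
   also for T*M, which is not given as a smooth_manifold. *)
Definition differentiable_atlas_at (R : realType) (n : nat) (T : Type)
    (A : atlas R n T) (x : T) : Prop :=
  [/\ forall (c : chart A) y, dom c y -> param c (coord c y) = y,
      forall c : chart A, dom c x -> \forall y \near coord c x, coord c (param c y) = y,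
      forall c d : chart A, dom c x -> dom d x ->
        \forall y \near coord c x, dom d (param c y) &
      forall c d : chart A, dom c x -> dom d x ->
        differentiable (transition c d) (coord c x)].

(** * Components of tangent vectors and covectors in charts *)

Section TangentComponents.
Context {R : realType} {n : nat} {T : Type} {A : atlas R n T} {x : T}.
Context (hx : differentiable_atlas_at A x).
Implicit Types c d e : chart A.

Lemma transition_coord c d : dom c x -> transition c d (coord c x) = coord d x.
Proof. by case: hx => paramK _ _ _ xc; rewrite /transition /= paramK. Qed.

(** The chain rule for the cocycle identity of transition maps, which holds near [coord c x]. It is
    what makes tangent vectors with prescribed components exist. *)
Lemma diff_transition_comp c d e u : dom c x -> dom d x -> dom e x ->
  'd (transition d e) (coord d x) ('d (transition c d) (coord c x) u) =
  'd (transition c e) (coord c x) u.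
Proof.
case: hx => paramK _ near_dom td xc xd xe.
have D := is_diff_comp_at (transition_coord d xc) (td _ _ xc xd) (td _ _ xd xe).
rewrite -[LHS]/(('d _ _ \o 'd _ _) u) -(@diff_val _ _ _ _ _ _ _ D).
have E : {near coord c x, transition c e =1 transition d e \o transition c d}.
  by apply: filterS (near_dom _ _ xc xd) => y yd; rewrite /transition /= paramK.
exact: (congr1 (fun f => f u) (near_eq_diff E (td _ _ xc xe))).
Qed.

Lemma diff_transition_id c u : dom c x -> 'd (transition c c) (coord c x) u = u.
Proof.
case: hx => _ coordK _ _ xc.
rewrite (@near_eq_diff _ _ _ id) ?diff_val//.
by apply: filterS (coordK _ xc) => y.
Qed.

Lemma tangent_transition (v : tangent A x) c d : dom c x -> dom d x ->
  v d = 'd (transition c d) (coord c x) (v c).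
Proof. by have /asboolP[_ vE] := comp_tangent v => ? ?; exact: vE. Qed.

Lemma tangent_eq c (v w : tangent A x) : dom c x -> v c = w c -> v = w.
Proof.
move=> xc vw; apply: val_inj; apply/funext => d /=.
have [xd|xd] := pselect (dom d x).
  apply: etrans (esym (tangent_transition w xc xd)).
  by rewrite -vw; exact: tangent_transition.
have /asboolP[v0 _] := comp_tangent v; have /asboolP[w0 _] := comp_tangent w.
by rewrite v0// w0.
Qed.

Lemma tvecE c (u : 'rV[R]_n) : dom c x -> tvec x c u c = u.
Proof.
move=> xc; apply: (@xgetPex _ 0 [set v : tangent A x | v c = u]).
pose v d := if pselect (dom d x) then 'd (transition c d) (coord c x) u else 0.
have vE d : dom d x -> v d = 'd (transition c d) (coord c x) u.
  by rewrite /v; case: pselect.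
have tv : v \in @tangent_pred R n T A x.
  apply/asboolP; split=> [d|d e xd xe]; first by rewrite /v; case: pselect.
  by rewrite (vE _ xd) (vE _ xe); exact/esym/diff_transition_comp.
exists (Tangent tv); exact: etrans (vE _ xc) (diff_transition_id _ xc).
Qed.

(** Expand [v] in the coordinate basis of [c], which exists by [tvecE], and apply linearity of
    [p]. *)
Lemma cotangent_comp c (p : cotangent A x) (v : tangent A x) : dom c x ->
  p v = \sum_(i < n) cocomp p c 0 i * v c 0 i.
Proof.
move=> xc.
have sumE (f : 'I_n -> tangent A x) : (\sum_(i < n) f i) c = \sum_(i < n) f i c.
  exact: (big_morph (fun w : tangent A x => w c)).
have vE : v = \sum_(i < n) v c 0 i *: tvec x c (delta_mx 0 i).
  apply: (tangent_eq xc); rewrite [LHS]row_sum_delta sumE; apply: eq_bigr => i _.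
  exact: (congr1 (fun w => v c 0 i *: w) (esym (tvecE _ xc))).
rewrite [in LHS]vE linear_sum; apply: eq_bigr => i _.
by rewrite linearZ /= mxE mulrC.
Qed.

End TangentComponents.

(** * Overlaps and transition maps of a smooth manifold *)

Section Manifold.
Context {R : realType} {n : nat} {M : topologicalType} {A : atlas R n M}.
Context (hM : smooth_manifold A).
Implicit Types c d e : chart A.

Lemma near_chart c d x : dom c x -> dom d x ->
  \forall y \near coord c x,
    [/\ dom c (param c y), dom d (param c y) & coord c (param c y) = y].
Proof.
move=> xc xd; have cx : (coord c @` dom c) (coord c x) by exists x.
have nc : \forall y \near coord c x, (coord c @` dom c) y.
  by apply: open_nbhs_nbhs; split=> //; exact: open_coord.
have nd : \forall y \near coord c x, dom d (param c y).
  have px : param c @ coord c x --> x.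
    by rewrite -[X in _ --> X](coordK hM xc); exact: param_continuous.
  by apply: px; apply: open_nbhs_nbhs; split=> //; exact: open_dom.
by apply: filterS2 nc nd => _ [y yc <-]; rewrite coordK.
Qed.

Lemma Ck_transition k c d x : dom c x -> dom d x ->
  exists U, [/\ open U, U (coord c x) & Ck_on k U (transition c d)].
Proof.
move=> xc xd; exists (coord c @` (dom c `&` dom d)); split.
- rewrite openE => _ [y [yc yd] <-].
  by apply: filterS (near_chart yc yd) => z [zc zd <-]; exists (param c z).
- by exists x.
- exact: transition_smooth.
Qed.

Lemma manifold_differentiable_atlas x : differentiable_atlas_at A x.
Proof.
split=> [c y|c xc|c d xc xd|c d xc xd]; first exact: coordK.
- by apply: filterS (near_chart xc xc) => y [].
- by apply: filterS (near_chart xc xd) => y [].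
- by have [U [_ Ux [td _]]] := Ck_transition 1 xc xd; exact: td.
Qed.

Lemma differentiable_derive_transition c d x v : dom c x -> dom d x ->
  differentiable ('D_v (transition c d)) (coord c x).
Proof.
move=> xc xd; have [U [_ Ux [_ td]]] := Ck_transition 2 xc xd.
by have [+ _] := td v; apply.
Qed.

End Manifold.

(** * The canonical charts of the cotangent bundle *)

Lemma near_lsubmx {R : numFieldType} {m n : nat} (P : set 'rV[R]_m)
    (l : 'rV[R]_m) (r : 'rV[R]_n) :
  (\forall y \near l, P y) -> \forall y \near row_mx l r, P (lsubmx y).
Proof.
move=> lP; have : lsubmx @ row_mx l r --> l.
  rewrite -[X in _ --> X](row_mxKl l r); exact: continuous_lsubmx.
exact.
Qed.

(** A covector packs a function with proofs of linearity, and the proofs are equal by proof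
    irrelevance. *)
Lemma cotangent_eq {R : realType} {n : nat} {T : Type} {A : atlas R n T} {x : T}
    (p q : cotangent A x) : p =1 q -> p = q.
Proof.
move=> /funext; case: p q => [p [[pD] [pZ]]] [q [[qD] [qZ]]] /= pq.
by subst q; congr (GRing.Linear.Pack (GRing.Linear.Class _ _)); congr (_ _);
  exact: Prop_irrelevance.
Qed.

Section CotangentAtlas.
Context {R : realType} {n : nat} {M : topologicalType} {A : atlas R n M}.
Context (hM : smooth_manifold A).
Implicit Types c d e : chart A.

Let hA x := manifold_differentiable_atlas hM x.

Lemma cocomp_covec c x (u : 'rV[R]_n) : dom c x -> cocomp (covec x c u) c = u.
Proof.
move=> xc; apply/rowP => i; rewrite mxE /= /covec_fun (bigD1 i)//=.
rewrite (tvecE (hA x) _ xc) mxE !eqxx mulr1 big1 ?addr0// => j ji.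
by rewrite mxE eqxx (negbTE ji) mulr0.
Qed.

Lemma covec_cocomp c x (p : cotangent A x) : dom c x -> covec x c (cocomp p c) = p.
Proof.
by move=> xc; apply: cotangent_eq => v; rewrite [RHS](cotangent_comp (hA x) _ _ xc).
Qed.

Lemma cotangent_paramK c (z : cotangent_bundle A) : dom c (projT1 z) ->
  @param _ _ _ (cotangent_atlas A) c (@coord _ _ _ (cotangent_atlas A) c z) = z.
Proof.
case: z => x p /= xc; rewrite row_mxKl row_mxKr coordK//.
by rewrite covec_cocomp.
Qed.

(** Covectors transform by the transposed Jacobian of the inverse transition. Its base point is
    written as a function of the coordinates in [c], so that the formula can be differentiated in
    them. *)
Lemma cocomp_transition c d x (u : 'rV[R]_n) i : dom c x -> dom d x ->
  cocomp (covec x c u) d 0 i =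
  \sum_(j < n) u 0 j *
    'D_(delta_mx 0 i) (transition d c) (transition c d (coord c x)) 0 j.
Proof.
move=> xc xd; rewrite mxE /= /covec_fun; apply: eq_bigr => j _; congr (_ * _).
rewrite (transition_coord (hA x) d xc) deriveE; last first.
  by have [_ _ _ ] := hA x; apply.
rewrite (tangent_transition (tvec x d (delta_mx 0 i)) xd xc).
by rewrite (tvecE (hA x) _ xd).
Qed.

(** The momentum part of the transition contains first derivatives of [transition d c], so its
    differentiability rests on the second-order smoothness of the atlas of [M]. *)
Lemma differentiable_cotangent_transition c d x (u : 'rV[R]_n) :
  dom c x -> dom d x ->
  differentiable (@transition _ _ _ (cotangent_atlas A) c d) (row_mx (coord c x) u).
Proof.
move=> xc xd; have [_ _ _ dt] := hA x.
pose g (y : 'rV[R]_(n + n)) : 'rV[R]_(n + n) :=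
  (* The transition of the cotangent bundle in closed form, valid where [lsubmx y] stays in the
     overlap of the two charts. *)
  row_mx (transition c d (lsubmx y))
    (\row_i \sum_(j < n) rsubmx y 0 j *
      'D_(delta_mx 0 i) (transition d c) (transition c d (lsubmx y)) 0 j).
have E : {near row_mx (coord c x) u,
    g =1 @transition _ _ _ (cotangent_atlas A) c d}.
  apply: filterS (near_lsubmx u (near_chart hM xc xd)) => y [yc yd cy].
  rewrite /g /transition /=; congr row_mx; apply/rowP => i.
  by rewrite cocomp_transition// !mxE cy.
apply: near_eq_differentiable E _.
have dl : differentiable (fun y : 'rV[R]_(n + n) => transition c d (lsubmx y))
    (row_mx (coord c x) u).
  apply: (differentiable_comp (f := lsubmx)); first exact: differentiable_lsubmx.
  by rewrite row_mxKl; exact: dt.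
apply: differentiable_row_mx; first exact: dl.
apply: differentiable_row => i.
pose D j (y : 'rV[R]_(n + n)) : R :=
  'D_(delta_mx 0 i) (transition d c) (transition c d (lsubmx y)) 0 j.
rewrite (_ : (fun _ => _) = \sum_(j < n) (fun y => rsubmx y 0 j) * D j); last first.
  by apply/funext => y; rewrite mxE fct_sumE.
apply: differentiable_sum => j; apply: differentiableM.
  exact/differentiable_entry/differentiable_rsubmx.
apply: differentiable_entry.
apply: (differentiable_comp (g := 'D_(delta_mx 0 i) (transition d c)) dl).
rewrite row_mxKl (transition_coord (hA x) d xc).
exact: differentiable_derive_transition.
Qed.

(** This makes [tvecE] available on the cotangent bundle, hence coordinate vectors to test the
    Hamiltonian equation against. *)
Lemma cotangent_differentiable_atlas (z : cotangent_bundle A) :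
  differentiable_atlas_at (cotangent_atlas A) z.
Proof.
case: z => x p; split=> [c w|c xc|c d xc xd|c d xc xd].
- exact: cotangent_paramK.
- apply: filterS (near_lsubmx (cocomp p c) (near_chart hM xc xc)) => y [yc _ cy].
  by rewrite /= cocomp_covec// cy hsubmxK.
- by apply: filterS (near_lsubmx (cocomp p c) (near_chart hM xc xd)) => y [].
- exact: differentiable_cotangent_transition.
Qed.

End CotangentAtlas.

Lemma diff_row_mx_left {R : numFieldType} {W : normedModType R} {m n : nat}
    (g : 'rV[R]_(m + n) -> W) (l : 'rV[R]_m) (r : 'rV[R]_n) (u : 'rV[R]_m) :
  differentiable g (row_mx l r) ->
  'd g (row_mx l r) (row_mx u 0) = 'D_u (fun y => g (row_mx y r)) l.
Proof.
move=> dg; apply: etrans (esym (deriveE _ dg)) _.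
apply: (@derive_comp_affine _ _ _ _ (fun y => row_mx y r)) => h.
by rewrite scale_row_mx add_row_mx scaler0 add0r.
Qed.

(** * The momentum half of Hamilton's equations *)

Section HamiltonianField.
Context {R : realType} {n : nat} {M : topologicalType} {A : atlas R n M}.
Context (hM : smooth_manifold A).
Context (f : vector_field A) (L : M -> R).
Context (hf : smooth_vector_field f) (hL : smooth_function A L).

Lemma differentiable_vector_field (c : chart A) x : dom c x ->
  differentiable (fun y => f (param c y) c) (coord c x).
Proof. by move=> xc; have [+ _] := hf c 1; apply; exists x. Qed.

Lemma differentiable_function (c : chart A) x : dom c x ->
  differentiable (L \o param c) (coord c x).
Proof. by move=> xc; have [+ _] := hL c 1; apply; exists x. Qed.

Lemma differentiable_adjoint_hamiltonian (c : chart A) x (r : 'rV[R]_n) :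
  dom c x ->
  differentiable (adjoint_hamiltonian f L \o @param _ _ _ (cotangent_atlas A) c)
    (row_mx (coord c x) r).
Proof.
move=> xc.
have dl : differentiable (lsubmx : 'rV[R]_(n + n) -> 'rV[R]_n) (row_mx (coord c x) r).
  exact: differentiable_lsubmx.
have df : differentiable ((fun y => f (param c y) c) \o lsubmx) (row_mx (coord c x) r).
  apply: differentiable_comp; rewrite ?row_mxKl//.
  exact: differentiable_vector_field.
have dL : differentiable ((L \o param c) \o lsubmx) (row_mx (coord c x) r).
  by apply: differentiable_comp; rewrite ?row_mxKl//; exact: differentiable_function.
rewrite (_ : _ \o _ = (\sum_(i < n) (fun y => rsubmx y 0 i) *
    (fun y => f (param c (lsubmx y)) c 0 i)) + ((L \o param c) \o lsubmx)); last first.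
  by apply/funext => y; rewrite !fctE fct_sumE.
apply: differentiableD dL; apply: differentiable_sum => i; apply: differentiableM.
  exact/differentiable_entry/differentiable_rsubmx.
exact: differentiable_entry df.
Qed.

Lemma derive_adjoint_hamiltonian (c : chart A) x (r u : 'rV[R]_n) : dom c x ->
  'D_u (fun l => (adjoint_hamiltonian f L \o @param _ _ _ (cotangent_atlas A) c)
                   (row_mx l r)) (coord c x) =
  \sum_(i < n) r 0 i * 'd (fun y => f (param c y) c) (coord c x) u 0 i +
    'd (L \o param c) (coord c x) u.
Proof.
move=> xc.
have df := differentiable_vector_field xc.
have dL := differentiable_function xc.
rewrite (_ : (fun _ => _) = (\sum_(i < n) r 0 i \*: (fun y => f (param c y) c 0 i)) +
    (L \o param c)); last first.
  apply/funext => l; rewrite !fctE fct_sumE /adjoint_hamiltonian /= /covec_fun.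
  by rewrite row_mxKl row_mxKr.
have Df : is_derive (coord c x) u (fun y => f (param c y) c)
    ('d (fun y => f (param c y) c) (coord c x) u).
  by apply: DeriveDef; [exact: diff_derivable|exact: deriveE].
have DL : is_derive (coord c x) u (L \o param c) ('d (L \o param c) (coord c x) u).
  by apply: DeriveDef; [exact: diff_derivable|exact: deriveE].
have Dfi i := is_deriveZ (r 0 i) (is_derive_coord i Df).
have := is_deriveD (is_derive_sum Dfi) DL.
by move=> /@derive_val.
Qed.

Context (X : vector_field (cotangent_atlas A)).
Context (hX : hamiltonian_field (adjoint_hamiltonian f L) X).

(** Against a vector with components [(u, 0)] the symplectic form only sees the momentum part of
    [X], with a minus sign. The chart is [chart_at A x] because [symplectic_form] and [dfun] are
    computed in it. *)
Lemma hamiltonian_momentum x (p : cotangent A x) (u : 'rV[R]_n) :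
  let c := chart_at A x in
  \sum_(i < n) rsubmx (X (existT _ x p) c) 0 i * u 0 i =
  - (\sum_(i < n) cocomp p c 0 i * 'd (fun y => f (param c y) c) (coord c x) u 0 i +
      'd (L \o param c) (coord c x) u).
Proof.
move=> c; have xc : dom c x by exact: dom_chart_at.
pose z : cotangent_bundle A := existT _ x p.
pose Y := @tvec _ _ _ (cotangent_atlas A) z c (row_mx u 0).
have YE : Y c = row_mx u 0 by exact: (tvecE (cotangent_differentiable_atlas hM z)).
have dH := differentiable_adjoint_hamiltonian (cocomp p c) xc.
rewrite -(derive_adjoint_hamiltonian (cocomp p c) u xc) -(diff_row_mx_left _ dH).
have := hX Y; rewrite /symplectic_form /dfun /= -/c YE => <-.
rewrite -sumrN; apply: eq_bigr => i _.
by rewrite row_mxKl row_mxKr [X in _ * X - _]mxE mulr0 sub0r opprK.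
Qed.

End HamiltonianField.

(** * The tangent lift in coordinates *)

Lemma near_section {R : numFieldType} {V W : normedModType R} (O : set (V * W))
    (x : V) (y : W) : open O -> O (x, y) ->
  exists P Q, [/\ nbhs x P, nbhs y Q & forall u w, P u -> Q w -> O (u, w)].
Proof.
move=> oO Oxy; have [[P Q] /= [xP yQ] PQ] := open_nbhs_nbhs (conj oO Oxy).
by exists P, Q; split=> // u w Pu Qw; exact: (PQ (u, w)).
Qed.

Section TangentLift.
Context {R : realType} {n : nat} {M : topologicalType} {A : atlas R n M}.
Context (hM : smooth_manifold A).
Implicit Types c d : chart A.

Let hA x := manifold_differentiable_atlas hM x.

(* tmap is defined with preferred charts; here any charts c and d are allowed. *)
Lemma tmapE (g : M -> M) x (v : tangent A x) c d : dom c x -> dom d (g x) ->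
  (\forall y \near coord c x, dom (chart_at A (g x)) (g (param c y))) ->
  differentiable (coord (chart_at A (g x)) \o g \o param c) (coord c x) ->
  differentiable (coord d \o g \o param c) (coord c x) /\
  tmap g v d = 'd (coord d \o g \o param c) (coord c x) (v c).
Proof.
move=> xc gxd.
set d0 := chart_at A (g x); set c0 := chart_at A x => gd0 dgd0.
have xc0 : dom c0 x by exact: dom_chart_at.
have gxd0 : dom d0 (g x) by exact: dom_chart_at.
have [paramK _ _ dtx] := hA x; have [_ _ _ dtgx] := hA (g x).
(* [E0] changes the source chart and [E1] the target chart; the chain rule applied to each relates
   the two coordinate forms of the tangent map. *)
have E0 : {near coord c0 x, (coord d0 \o g \o param c) \o transition c0 c =1
    coord d0 \o g \o param c0}.
  apply: filterS (near_chart hM xc0 xc) => y [_ yc _].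
  by rewrite /transition /= paramK.
have E1 : {near coord c x, transition d0 d \o (coord d0 \o g \o param c) =1
    coord d \o g \o param c}.
  by apply: filterS gd0 => y gyd0; rewrite /transition /= paramK.
have gE : (coord d0 \o g \o param c) (coord c x) = coord d0 (g x).
  by rewrite /= paramK.
have D0 := near_eq_is_diff E0
  (is_diff_comp_at (transition_coord (hA x) c xc0) (dtx _ _ xc0 xc) dgd0).
have D1 := near_eq_is_diff E1 (is_diff_comp_at gE dgd0 (dtgx _ _ gxd0 gxd)).
split; first exact: ex_diff.
apply: etrans (congr1 (fun h => h (v c)) (esym (@diff_val _ _ _ _ _ _ _ D1))).
rewrite /= (tangent_transition v xc0 xc).
apply: etrans (tangent_transition (tmap g v) gxd0 gxd) _; congr ('d _ _ _).
rewrite /tmap (tvecE (hA (g x)) _ gxd0).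
have := @diff_val _ _ _ _ _ _ _ D0.
by move=> /(congr1 (fun h : 'rV[R]_n -> 'rV[R]_n => h (v c0))).
Qed.

(** The local flow brings its own source chart [c'], while components are read in [c]. The flow is
    therefore studied as [G], with [c'] at the source and [c] at the target, and the transition from
    [c'] to [c] is removed by the chain rule at the end. *)
Lemma tangent_lift_comp (f : vector_field A) (F : vector_field (tangent_atlas A))
    x (v : tangent A x) c :
  smooth_vector_field f -> tangent_lift f F -> dom c x ->
  rsubmx (F (existT _ x v) c) = 'd (fun y => f (param c y) c) (coord c x) (v c).
Proof.
move=> hf hF xc.
have [Phi [[a [c' [U [[a0 Ux Uc' oU] [Phi0 Phif PhiS]]]]] [_ /(_ c xc)[_ hv]]]] :=
  hF (existT _ x v).
have xc' : dom c' x := Uc' _ Ux.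
have [paramK _ _ dt] := hA x.
have a00 : `|0 : R| < a by rewrite normr0.
have Phix : dom c (Phi 0 x) by rewrite Phi0.
(* Second-order smoothness of [G] near [(0, y0)] is what the symmetry of mixed derivatives needs. *)
have [W [oW Wx Wc /(_ 2%N) WS]] := PhiS 0 x c a00 Ux Phix.
set y0 := coord c' x in Wx *.
pose G (y : R * 'rV[R]_n) := coord c (Phi y.1 (param c' y.2)).
have [P [Q [nP nQ PQ]]] := near_section oW Wx.
have tmapG e : `|e| < a -> P e ->
    tmap (Phi e) v c = 'D_((0 : R), v c') G (e, y0).
  move=> ea Pe.
  have gxc : dom c (Phi e x).
    have := Wc (e, y0) (PQ _ _ Pe (nbhs_singleton nQ)).
    by rewrite /= paramK.
  have gxd : dom (chart_at A (Phi e x)) (Phi e x) by exact: dom_chart_at.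
  (* Smoothness is invoked again at time [e], in the preferred chart at [Phi e x], since [tmap] is
     defined through that chart and [tmapE] requires differentiability there. *)
  have [W' [oW' Wx' Wc' /(_ 1%N)[WS' _]]] := PhiS e x _ ea Ux gxd.
  have [P' [Q' [nP' nQ' PQ']]] := near_section oW' Wx'.
  have [||dK ->] := @tmapE (Phi e) x v c' c xc' gxc.
  - apply: filterS nQ' => y Qy.
    exact: Wc' (e, y) (PQ' _ _ (nbhs_singleton nP') Qy).
  - pose j (y : 'rV[R]_n) : R * 'rV[R]_n := (e, y).
    have dj : differentiable j y0 by exact: differentiable_pair.
    exact: differentiable_comp dj (WS' _ Wx').
  apply: etrans (esym (deriveE _ dK)) _; apply/esym.
  apply: (@derive_comp_affine _ _ _ _ (fun y => (e, y)) G) => h.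
  by congr pair; rewrite /= scaler0 add0r.
(* The fibre part of the velocity defining [F] is thus a mixed second derivative of [G], time
   direction last. *)
have D : is_derive (0 : R) (1 : R) (fun e : R => 'D_((0 : R), v c') G (e, y0))
    (rsubmx (F (existT _ x v) c)).
  have hv2 := is_derive_linear (@continuous_rsubmx R 1 n n) hv.
  apply: near_eq_is_derive hv2.
  have na : \forall e \near (0 : R), `|e| < a.
    by apply/nbhs_normP; exists a => //= e; rewrite /= sub0r normrN.
  by apply: filterS2 na nP => e ea Pe; rewrite /= row_mxKr tmapG.
have {D}D : is_derive ((0 : R), y0) ((1 : R), (0 : 'rV[R]_n)) ('D_((0 : R), v c') G)
    (rsubmx (F (existT _ x v) c)).
  apply: (@is_derive_comp_affine _ _ _ _ (fun e : R => (e, y0))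
    ('D_((0 : R), v c') G) 0 1 _ _ _).2 D => h.
  by congr pair; rewrite /= ?scaler0 ?add0r.
rewrite -(@derive_val _ _ _ _ _ _ _ D) (Ck2_derive_sym _ _ oW Wx WS).
apply: etrans (@derive_comp_affine _ _ _ _ (fun y => ((0 : R), y)) _ y0 (v c') _ _) _.
  by move=> h; congr pair; rewrite /= scaler0 add0r.
(* With the order exchanged, the inner derivative is the initial velocity of the flow, which is [f]
   read in [c] at the point with coordinates [y] in [c']. *)
have E : {near y0, 'D_((1 : R), (0 : 'rV[R]_n)) G \o (fun y => ((0 : R), y)) =1
    (fun y => f (param c y) c) \o transition c' c}.
  have nU : \forall y \near y0, (coord c' @` U) y.
    by apply: open_nbhs_nbhs; split=> //; exists x.
  apply: filterS2 nU nQ => _ [u Uu <-] Qu.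
  have uc' := Uc' _ Uu.
  have uc : dom c (Phi 0 u).
    by have := Wc _ (PQ _ _ (nbhs_singleton nP) Qu); rewrite /= paramK.
  have [_ /(_ c uc)[_ /@derive_val Du]] := Phif 0 u a00 Uu.
  have uE : transition c' c (coord c' u) = coord c u by rewrite /transition /= paramK.
  rewrite /= uE paramK; last by rewrite -(Phi0 _ Uu).
  rewrite (Phi0 _ Uu) in Du; rewrite -Du.
  pose j (e : R) := (e, coord c' u).
  apply: etrans (@derive_comp_affine _ _ _ _ j _ 0 1 _ _) _.
    by move=> h; congr pair; rewrite /= ?scaler0 ?add0r.
  by congr (derive _ (0 : R) (1 : R)); apply/funext => e; rewrite /G /= paramK.
apply: etrans (near_eq_derive _ E) _.
have df := differentiable_vector_field hf xc.
have D' := is_diff_comp_at (transition_coord (hA x) c xc') (dt _ _ xc' xc) df.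
apply: etrans (deriveE _ (@ex_diff _ _ _ _ _ _ _ D')) _.
rewrite (tangent_transition v xc' xc).
have := @diff_val _ _ _ _ _ _ _ D'.
by move=> /(congr1 (fun h : 'rV[R]_n -> 'rV[R]_n => h (v c'))).
Qed.

End TangentLift.

(** * The derivative of the pairing along the two curves *)

Theorem proposition2p7 (R : realType) (n : nat) (M : topologicalType)
  (A : atlas R n M) (hM : smooth_manifold A)
  (f : vector_field A) (hf : smooth_vector_field f)
  (L : M -> R) (hL : smooth_function A L)
  (X : vector_field (cotangent_atlas A))
  (hX : hamiltonian_field (adjoint_hamiltonian f L) X)
  (F : vector_field (tangent_atlas A)) (hF : tangent_lift f F)
  (I : set R) (hI : is_interval I) (oI : open I)
  (q : R -> M) (p : forall t, cotangent A (q t)) (dq : forall t, tangent A (q t))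
  (hqp : integral_curve X I (fun t => existT (cotangent A) (q t) (p t)))
  (hqdq : integral_curve F I (fun t => existT (tangent A) (q t) (dq t))) :
  forall t, I t ->
    is_derive t 1 (fun s => p s (dq s)) (- dfun L (dq t)).
Proof.
move=> t It; set c := chart_at A (q t).
have hA s := manifold_differentiable_atlas hM (q s).
have xc : dom c (q t) by exact: dom_chart_at.
have rsubmxC := @continuous_rsubmx R 1 n n.
have [_ /(_ c xc)[near_c /(is_derive_linear rsubmxC) Dcp]] := hqp t It.
have [_ /(_ c xc)[_ /(is_derive_linear rsubmxC) Dcdq]] := hqdq t It.
have Dp : is_derive t (1 : R) (fun s => cocomp (p s) c)
    (rsubmx (X (existT _ (q t) (p t)) c)).
  by apply: near_eq_is_derive Dcp; apply: (@nearW _ (nbhs t)) => s; rewrite /= row_mxKr.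
have Ddq : is_derive t (1 : R) (fun s => comp (dq s) c)
    ('d (fun y => f (param c y) c) (coord c (q t)) (dq t c)).
  rewrite -(tangent_lift_comp hM (dq t) hf hF xc).
  apply: near_eq_is_derive Dcdq; apply: (@nearW _ (nbhs t)) => s.
  by rewrite /= row_mxKr.
have Di i := is_deriveM (is_derive_coord i Dp) (is_derive_coord i Ddq).
(* The coordinate formula for the pairing is valid while [q s] stays in the domain of [c], that is
   for [s] near [t]. *)
have pE : \near t, (\sum_(i < n) (fun s => cocomp (p s) c 0 i) *
    (fun s => comp (dq s) c 0 i)) t = p t (dq t).
  by apply: filterS near_c => s sc; rewrite fct_sumE (cotangent_comp (hA s) _ _ sc).
apply: is_derive_eq (near_eq_is_derive pE (is_derive_sum Di)) _.
(* Taking [u] to be the components of [dq t] produces the sum that the variational equation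
   contributes with the opposite sign. What remains is [dfun L] in its own chart [c]. *)
rewrite big_split /=; have := hamiltonian_momentum hM hf hL hX (p t) (dq t c).
rewrite -/c /= => H; under [X in _ + X]eq_bigr do rewrite [_ *: _]mulrC.
by rewrite H opprD addrA subrr add0r.
Qed.
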